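(* Let $n\ge1$. The space $H^{n/2}_{\mathcal D}(\mathbb R^n)$ is not an algebra under pointwise multiplication. In particular, let $\varepsilon_0=(0,1,\dots,1)\in\{0,1\}^n$, let $Q_k=[-2^{-k},0)^n\in\mathcal D$ for $k\ge 1$, and let $1<\alpha\le\frac32$. Then the function $$f:=\sum_{k>0}\frac{1}{2^{kn/2}k^{\alpha/2}}\,h_{Q_k}^{\varepsilon_0}$$ belongs to $H^{n/2}_{\mathcal D}(\mathbb R^n)$, while $f^2\notin H^{n/2}_{\mathcal D}(\mathbb R^n)$.
   Context: $\mathbb R^n$ carries Lebesgue measure, denoted $|\cdot|$; functions are real-valued. $\mathcal D$ is the standard dyadic grid: all cubes $Q=I_1\times\dots\times I_n$ where $I_1,\dots,I_n$ are dyadic intervals $[2^k m,2^k(m+1))$, $m\in\mathbb Z$, of the same length $2^k$, $k\in\mathbb Z$. For a dyadic interval $I$ with left half $I_-$ and right half $I_+$ put $h_I^0=|I|^{-1/2}(\mathbf 1_{I_+}-\mathbf 1_{I_-})$ and $h_I^1=|I|^{-1/2}\mathbf 1_I$. For $Q=I_1\times\dots\times I_n\in\mathcal D$ and $\varepsilon\in\{0,1\}^n\setminus\{(1,\dots,1)\}$ put $h_Q^\varepsilon(x)=\prod_{i=1}^n h_{I_i}^{\varepsilon_i}(x_i)$; these Haar functions form an orthonormal basis of $L^2(\mathbb R^n)$. ''$\varepsilon\not\equiv 1$'' means $\varepsilon\neq(1,\dots,1)$. Write $(f,g)=\int_{\mathbb R^n}fg\,dx$. For $s>0$ the dyadic fractional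 derivative is $D^s_{\mathcal D}f=\sum_{Q\in\mathcal D,\ \varepsilon\not\equiv1}|Q|^{-s/n}(f,h_Q^\varepsilon)h_Q^\varepsilon$, and $H^s_{\mathcal D}(\mathbb R^n)=\{f\in L^2(\mathbb R^n): D^s_{\mathcal D}f\in L^2(\mathbb R^n)\}$, where $D^s_{\mathcal D}f\in L^2$ means $\sum_{Q\in\mathcal D,\ \varepsilon\not\equiv1}|Q|^{-2s/n}|(f,h_Q^\varepsilon)|^2<\infty$. A space of functions is an algebra if it is closed under pointwise multiplication. *)

(* Defs.v *)
From HB Require Import structures.
From mathcomp Require Import all_boot all_order all_algebra.
From mathcomp Require Import all_classical all_reals all_analysis.

Set Implicit Arguments.
Unset Strict Implicit.
Unset Printing Implicit Defensive.
Import Order.TTheory GRing.Theory Num.Theory.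
Import numFieldNormedType.Exports.

Local Open Scope classical_set_scope.
Local Open Scope ring_scope.

Section tuple_measure.
Context d (T : measurableType d) (R : realType).
Variable m : {sigma_finite_measure set T -> \bar R}.
Local Open Scope ereal_scope.

Definition tuple_cons (n : nat) (p : T * n.-tuple T) : n.+1.-tuple T :=
  [tuple of p.1 :: p.2].

Definition tuple_uncons (n : nat) (x : n.+1.-tuple T) : T * n.-tuple T :=
  (thead x, [tuple of behead x]).

Lemma measurable_tuple_cons (n : nat) : measurable_fun setT (@tuple_cons n).
Proof. exact: measurable_cons. Qed.

Lemma measurable_tuple_uncons (n : nat) :
  measurable_fun setT (@tuple_uncons n).
Proof.
apply/measurable_fun_pairP; split; first exact: (measurable_tnth ord0).
exact: measurable_behead.
Qed.

Lemma tuple_consK (n : nat) : cancel (@tuple_cons n) (@tuple_uncons n).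
Proof. by case=> x y; congr pair; apply/val_inj. Qed.

Section step.
Context (n : nat) (mu : {sigma_finite_measure set (n.-tuple T) -> \bar R}).

Definition tuple_measureS : set (n.+1.-tuple T) -> \bar R :=
  pushforward (m \x mu) (@tuple_cons n).

Let measurable_preimage (A : set (n.+1.-tuple T)) :
  measurable A -> measurable (@tuple_cons n @^-1` A).
Proof.
by move=> mA; rewrite -[X in measurable X]setTI; exact: measurable_tuple_cons.
Qed.

Let tuple_measureS0 : tuple_measureS set0 = 0.
Proof. by rewrite /tuple_measureS /pushforward preimage_set0 measure0. Qed.

Let tuple_measureS_ge0 A : 0 <= tuple_measureS A.
Proof. by rewrite /tuple_measureS /pushforward measure_ge0. Qed.

Let tuple_measureS_sigma_additive : semi_sigma_additive tuple_measureS.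
Proof.
move=> F mF tF mUF; rewrite /tuple_measureS /pushforward preimage_bigcup.
apply: measure_semi_sigma_additive.
- by move=> k; exact: measurable_preimage.
- apply/trivIsetP => /= i j _ _ ij; rewrite -preimage_setI.
  by move/trivIsetP : tF => /(_ _ _ _ _ ij) ->//; rewrite preimage_set0.
- by rewrite -preimage_bigcup; exact: measurable_preimage.
Qed.

HB.instance Definition _ := isMeasure.Build _ _ _ tuple_measureS
  tuple_measureS0 tuple_measureS_ge0 tuple_measureS_sigma_additive.

Let tuple_measureS_sigma_finite : sigma_finite setT tuple_measureS.
Proof.
have /sigma_finiteP[F [TF ndF Foo]] := sigma_finiteT m.
have /sigma_finiteP[G [TG ndG Goo]] := sigma_finiteT mu.
exists (fun k => @tuple_uncons n @^-1` (F k `*` G k)).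
  apply/esym; rewrite -subTset => x _.
  have : setT (tuple_uncons x).1 by []. have : setT (tuple_uncons x).2 by [].
  rewrite {1}TF {1}TG => -[j _ Gj] [i _ Fi]; exists (maxn i j) => //; split.
    by move: Fi; exact/subsetPset/ndF/leq_maxl.
  by move: Gj; exact/subsetPset/ndG/leq_maxr.
move=> k; have [mF Fk] := Foo k; have [mG Gk] := Goo k; split.
  rewrite -[X in measurable X]setTI; apply: measurable_tuple_uncons => //.
  exact: measurableX.
rewrite /tuple_measureS /pushforward -comp_preimage.
rewrite (_ : _ \o _ = id); last by apply/funext => p; exact: tuple_consK.
by rewrite preimage_id product_measure1E// lte_mul_pinfty// ge0_fin_numE.
Qed.

HB.instance Definition _ := Measure_isSigmaFinite.Build _ _ _ tuple_measureS
  tuple_measureS_sigma_finite.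
End step.

Fixpoint tuple_measure (n : nat) :
    {sigma_finite_measure set (n.-tuple T) -> \bar R} :=
  match n with
  | 0 => \d_ [tuple]
  | k.+1 => tuple_measureS (tuple_measure k)
  end.

Lemma tuple_measure_box (n : nat) (A : 'I_n -> set T) :
  (forall i, measurable (A i)) ->
  tuple_measure n [set x | forall i, A i (tnth x i)] = \prod_(i < n) m (A i).
Proof.
elim: n A => [|n IH] A mA.
  by rewrite big_ord0 /= diracE mem_set//= => -[].
rewrite big_ord_recl /= /tuple_measureS /pushforward.
pose B := [set x : n.-tuple T | forall i, A (lift ord0 i) (tnth x i)].
have mB : measurable B.
  rewrite (_ : B = \bigcap_(i in [set: 'I_n])
    ((fun x : n.-tuple T => tnth x i) @^-1` A (lift ord0 i))).
    apply: fin_bigcap_measurable => // i _.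
    by rewrite -[X in measurable X]setTI; exact: measurable_tnth.
  by apply/seteqP; split => x /= h i; [move=> _|]; exact: h.
rewrite -IH//= -product_measure1E//; congr (_ _).
apply/seteqP; split => -[x y] /= h.
  split; first by have := h ord0.
  by move=> i; have := h (lift ord0 i); rewrite tnthS.
move: h => [h0 h] i; case: (unliftP ord0 i) => [j ->|->//].
by rewrite tnthS; exact: h.
Qed.

End tuple_measure.

(* Points of R^n are n-tuples, measurable for the product of the Borel
   sigma-algebras. *)
Notation Rn R n := (n.-tuple (measurableTypeR R)).

Definition lebesgueRn (R : realType) (n : nat) :
    {sigma_finite_measure set (Rn R n) -> \bar R} :=
  tuple_measure (@lebesgue_measure R) n.

Section dyadic_haar.
Context (R : realType).

Definition dyadic_itv (k m : int) : set R :=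
  `[(2 : R) ^ k * m%:~R, (2 : R) ^ k * (m + 1)%:~R[.

Definition itv_len (k m : int) : R := fine (lebesgue_measure (dyadic_itv k m)).

(* [false] is the exponent 0 and [true] the exponent 1. The left and right
   halves of [2^k m, 2^k (m + 1)[ are the dyadic intervals of length 2^(k - 1)
   with indices 2m and 2m + 1. *)
Definition haar1 (e : bool) (k m : int) (t : R) : R :=
  itv_len k m `^ (- 2^-1) *
  if e then \1_(dyadic_itv k m) t
  else \1_(dyadic_itv (k - 1) (2 * m + 1)) t - \1_(dyadic_itv (k - 1) (2 * m)) t.

Context (n : nat).

(* The index (k, m) stands for the cube with sides [2^k m_i, 2^k (m_i + 1)[. *)
Definition dyadic : Type := (int * {ffun 'I_n -> int})%type.

Definition cube (Q : dyadic) : set (Rn R n) :=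
  [set x | forall i : 'I_n, dyadic_itv Q.1 (Q.2 i) (tnth x i)].

Definition cube_vol (Q : dyadic) : R := fine (lebesgueRn R n (cube Q)).

Definition haar (Q : dyadic) (e : {ffun 'I_n -> bool}) (x : Rn R n) : R :=
  \prod_(i < n) haar1 (e i) Q.1 (Q.2 i) (tnth x i).

Definition inner (f g : Rn R n -> R) : R := \int[lebesgueRn R n]_x (f x * g x).

(* All pairs of a dyadic cube and an exponent other than (1, ..., 1). *)
Definition haar_indices : set (dyadic * {ffun 'I_n -> bool}) :=
  [set q | q.2 != [ffun=> true]].

Definition dyadic_sobolev (s : R) : set (Rn R n -> R) :=
  [set f | f \in Lfun (lebesgueRn R n) 2%:E /\
    (\esum_(q in haar_indices)
      (cube_vol q.1 `^ (- (2 * s / n%:R)) *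
       `|inner f (haar q.1 q.2)| ^+ 2)%:E < +oo)%E].

(* (0, 1, ..., 1) *)
Definition eps0 : {ffun 'I_n -> bool} := [ffun i : 'I_n => val i != 0%N].

(* [-2^(-k), 0[^n *)
Definition corner_cube (k : nat) : dyadic := (- k%:Z, [ffun=> -1]).

(* Pointwise sum over k >= 1; the corner cubes decrease to the empty set, so that
   at every point only finitely many terms are nonzero. *)
Definition corner_series (alpha : R) (x : Rn R n) : R :=
  limn (fun N : nat => \sum_(1 <= k < N)
    (2 `^ ((k * n)%:R / 2) * k%:R `^ (alpha / 2))^-1 *
    haar (corner_cube k) eps0 x).

End dyadic_haar.

Definition pointwise_algebra (X : Type) (R : realType) (A : set (X -> R)) : Prop :=
  forall f g : X -> R, A f -> A g -> A (fun x => f x * g x).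

(* Main.v *)
Require Import Defs.
From mathcomp Require Import all_boot all_order all_algebra.
From mathcomp Require Import all_classical all_reals all_analysis.
From mathcomp Require Import measurable_realfun.
From mathcomp Require Import ring lra zify.
(* From here on [dyadic_itv] is the interval indexed by scale and position. *)
Import Defs.
Set Implicit Arguments.
Unset Strict Implicit.
Unset Printing Implicit Defensive.
Import Order.TTheory GRing.Theory Num.Theory.
Import numFieldNormedType.Exports.
Local Open Scope classical_set_scope.
Local Open Scope ring_scope.

(** The series is built so that the corner cubes Q_k = [-2^-k, 0[^n are nested and
    each of them lies in the half of the previous one where the Haar function
    h_k := h_{Q_k}^{eps0} is positive. Write sigma_k for h_k divided by its
    height |Q_k|^(-1/2) and c_k := k^(-alpha/2); then f = sum_k c_k sigma_k.

    Since s = n/2, the weight of the Haar coefficient at Q is |Q|^-1. By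
    orthonormality the only nonzero coefficients of f are
    (f, h_k) = c_k |Q_k|^(1/2), so the Sobolev sum of f is sum_k c_k^2 =
    sum_k k^-alpha, finite because alpha > 1 ([inner_corner_sum],
    [corner_sum_sobolev], [sum_powR_le]).

    Squaring makes the low frequencies interact. On Q_k all sigma_j with j < k
    are equal to 1, so f = A_k + c_k sigma_k + T there, where
    A_k := sum_(j < k) c_j and T := sum_(j > k) c_j sigma_j is supported where
    sigma_k = 1. Expanding,

      f^2 sigma_k = (A_k^2 + c_k^2) sigma_k + 2 A_k c_k 1_{Q_k}
                    + 2 (A_k + c_k) T + T^2     ([corner_sum_sqr_sign]).

    The functions sigma_k and T have mean zero and T^2 >= 0, so
    (f^2, h_k) >= 2 A_k c_k |Q_k|^(1/2) and the Sobolev sum of f^2 is at least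
    sum_k (2 A_k c_k)^2. As c is nonincreasing, A_k >= (k - 1) c_k, and
    alpha <= 3/2 then makes the k-th term at least 1/k for k >= 2
    ([corner_coef_lower]): the sum diverges with the harmonic series.

    Two analytic facts support this. Integrals of products of functions of one
    coordinate factor ([tuple_prod_integral]), which reduces orthonormality to
    dimension one ([haar_orthonormal]). And the absolute values and the squares of f
    and of all its partial sums are bounded by the single integrable function
    G = sum_k (2k - 1) 1_{Q_k} ([corner_partial_le]), so that f is in L^2 and
    integrals against bounded functions pass to the limit by dominated
    convergence ([corner_sum_cvg_integral]). *)

(** * Integrals of products over tuples *)

Lemma le_integrableR d (T : measurableType d) (R : realType)
    (mu : {measure set T -> \bar R}) (f g : T -> R) :
  measurable_fun setT f -> (forall x, `|f x| <= g x) ->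
  mu.-integrable setT (EFin \o g) -> mu.-integrable setT (EFin \o f).
Proof.
move=> mf fg; apply: le_integrable => //; first exact/measurable_EFinP.
by move=> x _ /=; rewrite lee_fin (le_trans (fg x))// ler_norm.
Qed.

Lemma integrable_indicR d (T : measurableType d) (R : realType)
    (mu : {measure set T -> \bar R}) (A : set T) :
  measurable A -> (mu A < +oo)%E -> mu.-integrable setT (EFin \o \1_A).
Proof.
move=> mA Aoo; apply/integrableP; split; first exact/measurable_EFinP.
rewrite (eq_integral (fun x => (\1_A x)%:E)) => [|x _ /=].
  by rewrite integral_indic// setIT.
by rewrite ger0_norm.
Qed.

Section tuple_fubini.
Context d (T : measurableType d) (R : realType).
Variable m : {sigma_finite_measure set T -> \bar R}.

Lemma measurable_tuple_prod n (F : 'I_n -> T -> R) :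
  (forall i, measurable_fun setT (F i)) ->
  measurable_fun setT (fun x : n.-tuple T => \prod_(i < n) F i (tnth x i)).
Proof.
move=> mF.
apply: (measurable_prod (h := fun i (x : n.-tuple T) => F i (tnth x i))).
by move=> i _; apply: measurableT_comp => //; exact: measurable_tnth.
Qed.

(** Fubini, one coordinate at a time: the measure on (n+1)-tuples is the image of
    a product measure. Integrability is carried along because each induction step
    needs it for the n remaining coordinates. *)
Lemma tuple_prod_integral n (F : 'I_n -> T -> R) :
  (forall i, m.-integrable setT (EFin \o F i)) ->
  (tuple_measure m n).-integrable setT
    (fun x => (\prod_(i < n) F i (tnth x i))%:E) /\
  \int[tuple_measure m n]_x (\prod_(i < n) F i (tnth x i)) =
  \prod_(i < n) \int[m]_t F i t.
Proof.
elim: n F => [|n IH] F iF.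
  have m1 : tuple_measure m 0 setT = 1%E.
    by exact: (diracT R ([tuple] : 0.-tuple T)).
  have E1 : (fun x : 0.-tuple T => (\prod_(i < 0) F i (tnth x i))%:E) = cst 1%E.
    by apply/funext => x /=; rewrite big_ord0.
  split; last first.
    rewrite /Rintegral E1 big_ord0 integral_cst ?measurableT//.
    by rewrite mul1e [X in fine X]m1.
  rewrite E1; apply/integrableP; split => //.
  under eq_integral do rewrite /= normr1.
  by rewrite integral_cst ?measurableT// mul1e [X in (X < _)%E]m1 ltry.
have mF i : measurable_fun setT (F i).
  by apply/measurable_EFinP; have /integrableP[] := iF i.
pose F' i := F (lift ord0 i).
have [iF' eF'] := IH F' (fun i => iF _).
set mu := tuple_measure m n in iF' eF' *.
pose G (y : n.-tuple T) := \prod_(i < n) F' i (tnth y i).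
pose H (p : T * n.-tuple T) := (F ord0 p.1 * G p.2)%:E.
have EH : (fun x : n.+1.-tuple T => (\prod_(i < n.+1) F i (tnth x i))%:E)
    \o @tuple_cons _ T n = H.
  apply/funext => -[t y] /=; rewrite /H big_ord_recl /=; congr (_ * _)%:E.
  by apply: eq_bigr => i _; rewrite tnthS.
have mG : measurable_fun setT G by apply: measurable_tuple_prod => i; exact: mF.
have mH : measurable_fun setT H.
  apply/measurable_EFinP; apply: measurable_funM => /=.
    by apply: measurableT_comp => //.
  by apply: measurableT_comp => //.
have iH : ((m \x mu)%E).-integrable setT H.
  apply/integrable12ltyP => //.
  rewrite (_ : (fun x => _) = (fun x => `|F ord0 x|%:E * \int[mu]_y `|G y|%:E)%E).
    rewrite ge0_integralZr//.
    - have /integrableP[_] := iF ord0; have /integrableP[_] := iF'.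
      move=> /= h1 h2; rewrite lte_mul_pinfty//; last first.
        by rewrite ge0_fin_numE//; apply: integral_ge0.
      exact: integral_ge0.
    - by apply/measurable_EFinP; apply: measurableT_comp.
    - exact: integral_ge0.
  apply/funext => x; rewrite /H /=.
  under eq_integral do rewrite normrM EFinM.
  by rewrite ge0_integralZl//; apply/measurable_EFinP; apply: measurableT_comp.
have mP := measurable_tuple_prod mF.
split.
  apply: (@integrable_pushforward _ _ _ _ _ _
    (@measurable_tuple_cons _ T n) (m \x mu)%E) => //.
    exact/measurable_EFinP.
  by rewrite preimage_setT EH.
rewrite /Rintegral.
have -> : (\int[tuple_measure m n.+1]_x (\prod_(i < n.+1) F i (tnth x i))%:E)%E
   = (\int[(m \x mu)%E]_x H x)%E.
  rewrite -EH /= (@integral_pushforward _ _ _ _ _ _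
    (@measurable_tuple_cons _ T n) (m \x mu)%E)//.
    exact/measurable_EFinP.
  by rewrite preimage_setT EH.
rewrite -integral12_prod_meas1// big_ord_recl -eF' /Rintegral.
rewrite -fineM ?integrable_fin_num//; last exact: iF.
congr fine.
rewrite -(fineK (integrable_fin_num measurableT iF')) -integralZr//; last exact: iF.
apply: eq_integral => x _.
by rewrite fineK ?integrable_fin_num// -integralZl.
Qed.
End tuple_fubini.

(** * Dyadic intervals *)

Section dyadic_intervals.
Variable R : realType.
Implicit Types (k m N : int) (t u : R).
Local Notation leb := (@lebesgue_measure R).

Lemma exp2z_gt0 k : 0 < (2 : R) ^ k.
Proof. exact: exprz_gt0. Qed.

Lemma dyadic_itvE k m t : dyadic_itv k m t <->
  ((2 : R) ^ k * m%:~R <= t /\ t < (2 : R) ^ k * (m + 1)%:~R).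
Proof.
by rewrite /dyadic_itv /= in_itv /=; split => [/andP[]|[-> ->]].
Qed.

Lemma dyadic_itv_left k m : dyadic_itv k m ((2 : R) ^ k * m%:~R).
Proof.
apply/dyadic_itvE; split => //.
by rewrite ltr_pM2l ?exp2z_gt0// ltr_int ltzD1.
Qed.

(** The integer multiples of 2^k do not separate the points of a dyadic interval
    of length 2^k; this is the source of the nestedness of the dyadic grid. *)
Lemma dyadic_itv_ge k m N t : dyadic_itv k m t ->
  ((2 : R) ^ k * N%:~R <= t) = (N <= m).
Proof.
move=> /dyadic_itvE[mt tm]; apply/idP/idP => [Nt|Nm].
  have := le_lt_trans Nt tm.
  by rewrite ltr_pM2l ?exp2z_gt0// ltr_int ltzD1.
by apply: le_trans mt; rewrite ler_pM2l ?exp2z_gt0// ler_int.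
Qed.

Lemma dyadic_itv_inj k m m' t :
  dyadic_itv k m t -> dyadic_itv k m' t -> m = m'.
Proof.
move=> tm tm'; apply/eqP; rewrite eq_le.
rewrite -(dyadic_itv_ge m tm') -(dyadic_itv_ge m' tm).
by move: tm tm' => /dyadic_itvE[-> _] /dyadic_itvE[-> _].
Qed.

(** Both endpoints of the coarser interval are multiples of 2^k, hence on the same
    side of t and of u. *)
Lemma dyadic_itv_coarse k k' m m' t u : k <= k' ->
  dyadic_itv k m t -> dyadic_itv k m u ->
  dyadic_itv k' m' t -> dyadic_itv k' m' u.
Proof.
move=> kk' tm um.
have kE N : (2 : R) ^ k' * N%:~R = (2 : R) ^ k * ((2 : int) ^+ `|k' - k|%N * N)%:~R.
  rewrite intrM rmorphXn/= mulrA; congr (_ * _).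
  rewrite [X in _ * X]exprnP -expfzDr//.
  by congr (_ ^ _); lia.
rewrite !dyadic_itvE !kE !ltNge !(dyadic_itv_ge _ tm) !(dyadic_itv_ge _ um).
by [].
Qed.

Lemma dyadic_itv_halves k m t :
  \1_(dyadic_itv (k - 1) (2 * m)) t + \1_(dyadic_itv (k - 1) (2 * m + 1)) t
  = \1_(dyadic_itv k m) t :> R.
Proof.
have kE : (2 : R) ^ k = (2 : R) ^ (k - 1) * 2.
  by rewrite -[in LHS](subrK 1 k) expfzDr// expr1z.
rewrite !indicE; set a := (2 : R) ^ (k - 1) in kE *.
have a0 : 0 < a by exact: exp2z_gt0.
rewrite /dyadic_itv !mem_setE !in_itv /= kE -/a !intrD !intrM.
have -> : a * 2 * m%:~R = a * (2%:~R * m%:~R) :> R by ring.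
have -> : a * 2 * (m%:~R + 1%:~R) = a * (2%:~R * m%:~R) + a + a :> R by ring.
have -> : a * (2%:~R * m%:~R + 1%:~R) = a * (2%:~R * m%:~R) + a :> R by ring.
have -> : a * (2%:~R * m%:~R + 1%:~R + 1%:~R) = a * (2%:~R * m%:~R) + a + a :> R.
  by ring.
set L := a * (2%:~R * m%:~R).
rewrite [L + a <= t]leNgt.
case: (leP L t) => Lt; case: (ltP t (L + a)) => tM /=;
  case: (ltP t (L + a + a)) => tU; rewrite /= ?addr0 ?add0r //; exfalso; lra.
Qed.

Lemma measurable_dyadic_itv k m : measurable (dyadic_itv k m : set R).
Proof. exact: measurable_itv. Qed.

Lemma lebesgue_dyadic_itv k m : leb (dyadic_itv k m) = ((2 : R) ^ k)%:E.
Proof.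
rewrite /dyadic_itv lebesgue_measure_itv /= lte_fin.
rewrite ltr_pM2l ?exp2z_gt0// ltr_int ltzD1 lexx -EFinD.
rewrite -mulrBr -intrB addrAC subrr add0r mulr1//.
Qed.

Lemma itv_lenE k m : itv_len R k m = (2 : R) ^ k.
Proof. by rewrite /itv_len lebesgue_dyadic_itv. Qed.

End dyadic_intervals.

(** * Haar functions on the line *)

Section haar1_theory.
Variable R : realType.
Implicit Types (k m : int) (t : R).
Local Notation leb := (@lebesgue_measure R).

(** The sup norm of a Haar function of an interval of length 2^k. *)
Definition haar1_height k : R := ((2 : R) ^ k) `^ (- 2^-1).

Lemma haar1E e k m t : haar1 e k m t = haar1_height k *
  if e then \1_(dyadic_itv k m) t
  else \1_(dyadic_itv (k - 1) (2 * m + 1)) t - \1_(dyadic_itv (k - 1) (2 * m)) t.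
Proof. by rewrite /haar1 itv_lenE. Qed.

Lemma haar1_height_gt0 k : 0 < haar1_height k.
Proof. by rewrite powR_gt0// exp2z_gt0. Qed.

Lemma haar1_heightK k : haar1_height k ^+ 2 * (2 : R) ^ k = 1.
Proof.
rewrite -powR_mulrn ?powR_ge0// -powRrM mulNr mulVf ?pnatr_eq0//.
by rewrite powR_inv1 ?ltW ?exp2z_gt0// mulVf// gt_eqF// exp2z_gt0.
Qed.

Lemma normr_haar1 e k m t :
  `|haar1 e k m t| = haar1_height k * \1_(dyadic_itv k m) t.
Proof.
rewrite haar1E normrM (gtr0_norm (haar1_height_gt0 k)); congr (_ * _).
case: e; first by rewrite ger0_norm.
rewrite -(dyadic_itv_halves k m t) !indicE.
have [h1|h1] := boolP (t \in dyadic_itv (k - 1) (2 * m));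
  have [h2|h2] := boolP (t \in dyadic_itv (k - 1) (2 * m + 1)) => /=.
- move: h1 h2; rewrite !inE => h1 /(dyadic_itv_inj h1); lia.
- by rewrite sub0r addr0 normrN normr1.
- by rewrite subr0 add0r normr1.
- by rewrite subr0 add0r normr0.
Qed.

Lemma haar1_out e k m t : ~ dyadic_itv k m t -> haar1 e k m t = 0.
Proof.
move=> tI; apply/eqP; rewrite -normr_eq0 normr_haar1 indicE memNset//.
by rewrite mulr0.
Qed.

Lemma haar1_right e k m t :
  dyadic_itv (k - 1) (2 * m + 1) t -> haar1 e k m t = haar1_height k.
Proof.
move=> tr; have tl : ~ dyadic_itv (k - 1) (2 * m) t.
  by move=> /(dyadic_itv_inj tr); lia.
rewrite haar1E -dyadic_itv_halves !indicE (mem_set tr) (memNset tl).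
by case: e; rewrite ?add0r ?subr0 mulr1.
Qed.

Lemma haar1_sqr e k m t :
  haar1 e k m t ^+ 2 = haar1_height k ^+ 2 * \1_(dyadic_itv k m) t.
Proof.
rewrite -real_normK ?num_real// normr_haar1 exprMn indicE.
by case: (_ \in _); rewrite ?expr1n// expr0n.
Qed.

Lemma measurable_haar1 e k m : measurable_fun setT (haar1 e k m : R -> R).
Proof.
have mI l j : measurable_fun setT (\1_(dyadic_itv l j) : R -> R).
  by apply: measurable_indic; exact: measurable_dyadic_itv.
case: e.
  rewrite (_ : haar1 true k m = cst (haar1_height k) \* \1_(dyadic_itv k m)).
    by apply: measurable_funM.
  by apply/funext => t; rewrite haar1E.
rewrite (_ : haar1 false k m = cst (haar1_height k) \*
  (\1_(dyadic_itv (k - 1) (2 * m + 1)) \- \1_(dyadic_itv (k - 1) (2 * m)))).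
  by apply: measurable_funM => //; exact: measurable_funB.
by apply/funext => t; rewrite haar1E.
Qed.

Lemma integrable_dyadic_itv k m :
  leb.-integrable setT (EFin \o \1_(dyadic_itv k m)).
Proof.
by apply: integrable_indicR; [exact: measurable_dyadic_itv|
  rewrite [X in (X < _)%E]lebesgue_dyadic_itv ltry].
Qed.

Lemma integrable_scaled_dyadic_itv (c : R) k m :
  leb.-integrable setT (EFin \o (fun t => c * \1_(dyadic_itv k m) t)).
Proof. exact: (integrableZl _ _ (integrable_dyadic_itv k m)). Qed.

Lemma integrable_haar1 e k m : leb.-integrable setT (EFin \o haar1 e k m).
Proof.
apply: le_integrableR (integrable_scaled_dyadic_itv (haar1_height k) k m).
  exact: measurable_haar1.
by move=> t; rewrite normr_haar1.
Qed.

Lemma integrable_haar1M e k m e' k' m' :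
  leb.-integrable setT (EFin \o (fun t => haar1 e k m t * haar1 e' k' m' t)).
Proof.
apply: le_integrableR
  (integrable_scaled_dyadic_itv (haar1_height k * haar1_height k') k m).
  by apply: measurable_funM; exact: measurable_haar1.
move=> t; rewrite normrM !normr_haar1 mulrACA ler_wpM2l//.
  by rewrite mulr_ge0// ltW// haar1_height_gt0.
by rewrite -[leRHS]mulr1 ler_wpM2l// indicE lern1; case: (_ \in _).
Qed.

Lemma Rintegral_dyadic_itv k m :
  \int[leb]_t \1_(dyadic_itv k m) t = (2 : R) ^ k.
Proof.
rewrite /Rintegral integral_indic//; last exact: measurable_dyadic_itv.
by rewrite setIT [X in fine X]lebesgue_dyadic_itv.
Qed.

Lemma Rintegral_haar1 k m : \int[leb]_t haar1 false k m t = 0.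
Proof.
under eq_Rintegral do rewrite haar1E.
rewrite RintegralZl//; last first.
  apply: (integrableB _ (integrable_dyadic_itv _ _) (integrable_dyadic_itv _ _)).
  by [].
rewrite RintegralB//; try exact: integrable_dyadic_itv.
by rewrite !Rintegral_dyadic_itv subrr mulr0.
Qed.

(** The coarser Haar function is constant on the support of the finer one, which
    has mean zero; u is just a sample point of that support. *)
Lemma Rintegral_haar1_fine k m e k' m' : k < k' ->
  \int[leb]_t (haar1 false k m t * haar1 e k' m' t) = 0.
Proof.
move=> kk'; set u := (2 : R) ^ k * m%:~R.
have uI : dyadic_itv k m u by exact: dyadic_itv_left.
transitivity (\int[leb]_t (haar1 false k m t * haar1 e k' m' u)).
  apply: eq_Rintegral => t _; have [tI|tI] := pselect (dyadic_itv k m t).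
    have tu l j : k <= l -> \1_(dyadic_itv l j) t = \1_(dyadic_itv l j) u :> R.
      move=> kl; rewrite !indicE; congr (_ %:R); congr nat_of_bool.
      apply/idP/idP; rewrite !inE; first exact: (dyadic_itv_coarse kl tI uI).
      exact: (dyadic_itv_coarse kl uI tI).
    by rewrite !(haar1E e) !tu//; lia.
  by rewrite haar1_out// !mul0r.
by rewrite RintegralZr// ?Rintegral_haar1 ?mul0r//; exact: integrable_haar1.
Qed.

Lemma Rintegral_haar1_disjoint e e' k m m' : m != m' ->
  \int[leb]_t (haar1 e k m t * haar1 e' k m' t) = 0.
Proof.
move=> mm'; rewrite -[RHS](_ : \int[leb]_t 0 = 0); last first.
  by rewrite /Rintegral integral0.
apply: eq_Rintegral => t _; have [tI|tI] := pselect (dyadic_itv k m t).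
  rewrite [X in _ * X]haar1_out ?mulr0// => tI'.
  by move: mm'; rewrite (dyadic_itv_inj tI tI') eqxx.
by rewrite haar1_out// mul0r.
Qed.

(** For two different exponents on the same interval one function is a multiple of
    the indicator of the support of the other, which has mean zero. *)
Lemma Rintegral_haar1_neq e e' k m : e != e' ->
  \int[leb]_t (haar1 e k m t * haar1 e' k m t) = 0.
Proof.
wlog -> : e e' / e = false.
  move=> H; case: e => ee'; last exact: H.
  under eq_Rintegral do rewrite mulrC.
  by apply: H; case: e' ee'.
case: e' => // _.
transitivity (\int[leb]_t (haar1 false k m t * haar1_height k)).
  apply: eq_Rintegral => t _; have [tI|tI] := pselect (dyadic_itv k m t).
    by rewrite (haar1E true) indicE mem_set// mulr1.
  by rewrite haar1_out// !mul0r.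
by rewrite RintegralZr// ?Rintegral_haar1 ?mul0r//; exact: integrable_haar1.
Qed.

Lemma Rintegral_haar1_sqr e k m :
  \int[leb]_t (haar1 e k m t * haar1 e k m t) = 1.
Proof.
under eq_Rintegral do rewrite -expr2 haar1_sqr.
rewrite RintegralZl//; last exact: integrable_dyadic_itv.
by rewrite Rintegral_dyadic_itv haar1_heightK.
Qed.

End haar1_theory.

(** * Haar functions in dimension n *)

Section haar_theory.
Variables (R : realType) (n : nat).
Implicit Types (Q : dyadic n) (e : {ffun 'I_n -> bool}) (x : Rn R n).
Local Notation leb := (@lebesgue_measure R).
Local Notation lebn := (lebesgueRn R n).

Lemma measurable_haar Q e : measurable_fun setT (haar Q e : Rn R n -> R).
Proof.
apply: (measurable_tuple_prod (F := fun i => haar1 (e i) Q.1 (Q.2 i))) => i.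
exact: measurable_haar1.
Qed.

Lemma measurable_cube Q : measurable (cube Q : set (Rn R n)).
Proof.
rewrite (_ : cube Q = \bigcap_(i in [set: 'I_n])
    ((fun x : Rn R n => tnth x i) @^-1` dyadic_itv Q.1 (Q.2 i))).
  apply: fin_bigcap_measurable => // i _.
  rewrite -[X in measurable X]setTI; apply: measurable_tnth => //.
  exact: measurable_dyadic_itv.
by apply/seteqP; split => x /= h i; [move=> _|]; exact: h.
Qed.

Lemma lebesgueRn_cube Q : lebn (cube Q) = (((2 : R) ^ Q.1) ^+ n)%:E.
Proof.
rewrite [LHS](tuple_measure_box leb (A := fun i => dyadic_itv Q.1 (Q.2 i))) => [|i].
  2: exact: measurable_dyadic_itv.
rewrite (eq_bigr (fun=> ((2 : R) ^ Q.1)%:E)) => [|i _].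
  2: exact: lebesgue_dyadic_itv.
by rewrite prodEFin prodr_const card_ord.
Qed.

Lemma cube_volE Q : cube_vol R Q = ((2 : R) ^ Q.1) ^+ n.
Proof. by rewrite /cube_vol lebesgueRn_cube. Qed.

Lemma integrable_cube Q : lebn.-integrable setT (EFin \o \1_(cube Q)).
Proof.
apply: integrable_indicR; first exact: measurable_cube.
by rewrite [X in (X < _)%E]lebesgueRn_cube ltry.
Qed.

Lemma Rintegral_cube Q : \int[lebn]_x \1_(cube Q) x = ((2 : R) ^ Q.1) ^+ n.
Proof.
rewrite /Rintegral integral_indic//; last exact: measurable_cube.
by rewrite setIT [X in fine X]lebesgueRn_cube.
Qed.

Lemma normr_haar Q e x :
  `|haar Q e x| = haar1_height R Q.1 ^+ n * \1_(cube Q) x.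
Proof.
rewrite /haar normr_prod.
under eq_bigr do rewrite normr_haar1.
rewrite big_split prodr_const card_ord /=; congr (_ * _).
rewrite indicE; have [xQ|xQ] := pselect (cube Q x).
  by rewrite mem_set// big1// => i _; rewrite indicE mem_set.
rewrite memNset//; have /existsNP[i xi] := xQ.
by rewrite (bigD1 i)//= indicE memNset// mul0r.
Qed.

Lemma integrable_haar Q e : lebn.-integrable setT (EFin \o haar Q e).
Proof.
apply: (@le_integrableR _ _ _ _ _
  (fun x => haar1_height R Q.1 ^+ n * \1_(cube Q) x)).
- exact: measurable_haar.
- by move=> x; rewrite normr_haar.
- exact: (integrableZl _ _ (integrable_cube Q)).
Qed.

Lemma inner_haar_prod Q e Q' e' :
  inner (haar Q e) (haar Q' e') = \prod_(i < n)
    \int[leb]_t (haar1 (e i) Q.1 (Q.2 i) t * haar1 (e' i) Q'.1 (Q'.2 i) t).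
Proof.
have [_ <-] := tuple_prod_integral (m := leb)
  (fun i : 'I_n => integrable_haar1M R (e i) Q.1 (Q.2 i) (e' i) Q'.1 (Q'.2 i)).
by apply: eq_Rintegral => x _; rewrite /haar -big_split.
Qed.

Lemma haar_index_false e : e != [ffun=> true] -> exists i, e i = false.
Proof.
move=> /eqP ne; apply: contra_notP ne => /forallNP ne.
by apply/ffunP => i; rewrite ffunE; case: (e i) (ne i).
Qed.

Lemma Rintegral_haar Q e : e != [ffun=> true] -> \int[lebn]_x haar Q e x = 0.
Proof.
move=> e1.
have [_ ->] := tuple_prod_integral (m := leb)
  (fun i : 'I_n => integrable_haar1 R (e i) Q.1 (Q.2 i)).
have [i ei] := haar_index_false e1.
by rewrite (bigD1 i)//= ei Rintegral_haar1 mul0r.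
Qed.

(** One vanishing factor in the product over coordinates is enough. If the cubes
    have different sizes, take a coordinate where the exponent of the smaller cube
    is 0; otherwise a coordinate where the positions, or failing that the
    exponents, differ. *)
Lemma haar_orthonormal (q q' : dyadic n * {ffun 'I_n -> bool}) :
  haar_indices q -> haar_indices q' ->
  inner (haar q.1 q.2 : Rn R n -> R) (haar q'.1 q'.2) = (q == q')%:R.
Proof.
move: q q' => [[k m] e] [[k' m'] e'] /= /haar_index_false[i ei]
  /haar_index_false[i' ei'].
rewrite inner_haar_prod /=.
case: eqVneq => [[-> -> ->]|qq'].
  by rewrite big1// => j _; rewrite Rintegral_haar1_sqr.
have prod0 j (F : 'I_n -> R) : F j = 0 -> \prod_(i < n) F i = 0.
  by move=> Fj; rewrite (bigD1 j)//= Fj mul0r.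
have [kk'|k'k|kk'] := ltgtP k k'.
- by rewrite (prod0 i)// ei Rintegral_haar1_fine.
- rewrite (prod0 i')// ei'; under eq_Rintegral do rewrite mulrC.
  by rewrite Rintegral_haar1_fine.
- subst k'.
  have [mm'|/eqP mm'] := pselect (m = m').
    subst m'. have : e != e' by apply: contra_neq qq' => ->.
    move=> /eqP ee'; have [j ej] : exists j, e j != e' j.
      apply: contra_notP ee' => /forallNP h; apply/ffunP => j.
      by apply/eqP/negPn/negP/h.
    by rewrite (prod0 j)// Rintegral_haar1_neq.
  have [j mj] : exists j, m j != m' j.
    move/eqP: mm' => mm'; apply: contra_notP mm' => /forallNP h; apply/ffunP => j.
    by apply/eqP/negPn/negP/h.
  by rewrite (prod0 j)// Rintegral_haar1_disjoint.
Qed.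

End haar_theory.

(** * The corner cubes *)

Section corner_cubes.
Variables (R : realType) (n : nat).
Hypothesis n_gt0 : (0 < n)%N.
Implicit Types (x : Rn R n) (k : nat).

Lemma cube_cornerE k x : cube (corner_cube n k) x <->
  forall i, - 2 ^- k <= tnth x i /\ tnth x i < 0.
Proof.
rewrite /cube /corner_cube /=; split=> h i; have := h i.
all: rewrite ffunE dyadic_itvE -exprnN mulrN1 subrr mulr0; by move=> [].
Qed.

Lemma cube_corner_nested j k x : (j <= k)%N ->
  cube (corner_cube n k) x -> cube (corner_cube n j) x.
Proof.
move=> jk /cube_cornerE h; apply/cube_cornerE => i; have [h1 h2] := h i.
split=> //; apply: le_trans h1; rewrite lerN2 lef_pV2 ?posrE ?exprn_gt0//.
by rewrite ler_eXn2l ?ltr1n.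
Qed.

(** The corner cubes shrink to their missing vertex 0, so they have empty
    intersection. *)
Lemma cube_corner_finite x : exists K, forall k, (K <= k)%N ->
  ~ cube (corner_cube n k) x.
Proof.
pose t := tnth x (Ordinal n_gt0).
have [t0|t0] := leP 0 t.
  exists 0%N => k _ /cube_cornerE/(_ (Ordinal n_gt0))[_].
  by rewrite -/t ltNge t0.
pose K := Num.bound (- t)^-1.
exists K => k Kk /cube_cornerE/(_ (Ordinal n_gt0))[+ _]; rewrite -/t.
apply/negP; rewrite -ltNge ltrNr.
rewrite -[ltRHS]invrK ltf_pV2 ?posrE ?exprn_gt0 ?invr_gt0 ?oppr_gt0//.
have : (- t)^-1 < K%:R by apply: archi_boundP; rewrite invr_ge0 oppr_ge0 ltW.
move=> /lt_trans; apply; rewrite -natrX ltr_nat.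
by apply: leq_ltn_trans Kk _; exact: ltn_expl.
Qed.

(** The Haar function of the k-th corner cube, divided by its height: it takes
    the values 1, -1 and, off the cube, 0. *)
Definition corner_sign k x : R :=
  (haar1_height R (- k%:Z) ^+ n)^-1 * haar (corner_cube n k) (eps0 n) x.

Lemma haar_corner k x : haar (corner_cube n k) (eps0 n) x =
  haar1_height R (- k%:Z) ^+ n * corner_sign k x.
Proof. by rewrite /corner_sign mulVKf// gt_eqF// exprn_gt0// haar1_height_gt0. Qed.

Lemma normr_corner_sign k x : `|corner_sign k x| = \1_(cube (corner_cube n k)) x.
Proof.
have h0 : 0 < haar1_height R (- k%:Z) ^+ n by rewrite exprn_gt0// haar1_height_gt0.
by rewrite /corner_sign normrM normr_haar gtr0_norm ?invr_gt0// mulKf// gt_eqF.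
Qed.

Lemma corner_sign_out k x : ~ cube (corner_cube n k) x -> corner_sign k x = 0.
Proof.
by move=> xQ; apply/eqP; rewrite -normr_eq0 normr_corner_sign indicE memNset.
Qed.

Lemma corner_sign_sqr k x : cube (corner_cube n k) x -> corner_sign k x ^+ 2 = 1.
Proof.
move=> xQ; rewrite -real_normK ?num_real// normr_corner_sign indicE mem_set//.
by rewrite expr1n.
Qed.

(** The next corner cube lies in the right half of the present one in every
    coordinate, in particular in the first. *)
Lemma corner_sign_next k x : cube (corner_cube n k.+1) x -> corner_sign k x = 1.
Proof.
move=> xQ; rewrite /corner_sign /haar (eq_bigr (fun=> haar1_height R (- k%:Z))).
  by rewrite prodr_const card_ord mulVf// gt_eqF// exprn_gt0// haar1_height_gt0.
move=> i _ /=; rewrite ffunE; apply: haar1_right.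
have := xQ i; rewrite /= [in X in dyadic_itv _ X _]ffunE.
by congr (dyadic_itv _ _ _); [rewrite intS opprD addrC | rewrite ffunE].
Qed.

Lemma measurable_corner_sign k : measurable_fun setT (corner_sign k).
Proof.
rewrite (_ : corner_sign k = cst (haar1_height R (- k%:Z) ^+ n)^-1 \*
  haar (corner_cube n k) (eps0 n)) //.
by apply: measurable_funM => //; exact: measurable_haar.
Qed.

Lemma corner_haar_index k : haar_indices (corner_cube n k, eps0 n).
Proof.
apply/eqP => /ffunP/(_ (Ordinal n_gt0)).
by rewrite !ffunE.
Qed.

End corner_cubes.

(** * Numerical series *)

Section power_sums.
Variable R : realType.

(** Bounds the integral of the majorant of [corner_partial_le] in dimension one, the
    worst case. The right-hand side is the exact value for N > 0. *)
Lemma odd_geometric_le N : \sum_(0 <= k < N) (2 * k).-1%:R * 2^-1 ^+ k <=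
  3 - (4 * N + 2)%:R * 2^-1 ^+ N :> R.
Proof.
elim: N => [|[|N] IH]; first by rewrite big_geq// expr0; lra.
  by rewrite big_nat1 /= expr1; lra.
rewrite big_nat_recr//; apply: (le_trans (lerD IH (lexx _))).
rewrite [in leRHS]exprS.
have -> : (2 * N.+1).-1 = (2 * N + 1)%N by lia.
set p := 2^-1 ^+ N.+1; clearbody p.
lra.
Qed.

(** An elementary substitute for comparing k^-a with the integral of x^-a. With
    x = k + 1, y = k + 2 and b = a - 1, the bound x / y = 1 - 1/y <= exp(-1/y) gives
    x^-b >= y^-b exp(b / y) >= y^-b (1 + b / y). *)
Lemma powR_telescope (a : R) k : 1 < a ->
  (a - 1) * (k.+2%:R `^ a)^-1 <=
  (k.+1%:R `^ (a - 1))^-1 - (k.+2%:R `^ (a - 1))^-1.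
Proof.
move=> a1; set b := a - 1; have b0 : 0 < b by rewrite subr_gt0.
set x : R := k.+1%:R; set y : R := k.+2%:R.
have x0 : 0 < x by rewrite ltr0n.
have y0 : 0 < y by rewrite ltr0n.
have xy : x <= y * expR (- y^-1).
  have -> : x = y * (1 + - y^-1).
    by rewrite mulrDr mulr1 mulrN divff ?gt_eqF// /y -[k.+2]addn1 natrD addrK.
  by rewrite ler_pM2l// expR_ge1Dx.
have xb : x `^ b <= y `^ b * expR (- (b / y)).
  apply: le_trans (_ : (y * expR (- y^-1)) `^ b <= _).
    by rewrite ge0_ler_powR ?nnegrE ?(ltW b0) ?(ltW x0) ?mulr_ge0 ?expR_ge0 ?(ltW y0).
  by rewrite powRM ?expR_ge0 ?(ltW y0)// -expRM mulNr [y^-1 * b]mulrC.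
have yb0 : 0 < y `^ b by rewrite powR_gt0.
have : (y `^ b)^-1 * (1 + b / y) <= (x `^ b)^-1.
  apply: (@le_trans _ _ ((y `^ b)^-1 * expR (b / y))).
    by rewrite ler_wpM2l ?invr_ge0 ?powR_ge0// expR_ge1Dx.
  rewrite -[expR _]invrK -expRN -invfM lef_pV2 ?posrE ?powR_gt0//.
  by rewrite mulr_gt0// expR_gt0.
have -> : y `^ a = y * y `^ b.
  by rewrite /b mulr_powRB1 ?ltW// (lt_trans ltr01).
rewrite invfM mulrDr mulr1 => h.
by rewrite lerBrDl; apply: le_trans h; rewrite lerD2l [leLHS]mulrA [leLHS]mulrC.
Qed.

Lemma sum_powR_le (a : R) N : 1 < a ->
  \sum_(0 <= k < N) (k.+1%:R `^ a)^-1 <= 1 + (a - 1)^-1.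
Proof.
move=> a1; have b0 : 0 < a - 1 by rewrite subr_gt0.
case: N => [|N]; first by rewrite big_geq// addr_ge0// invr_ge0 ltW.
apply: (@le_trans _ _ (1 + (a - 1)^-1 * (1 - (N.+1%:R `^ (a - 1))^-1))).
  elim: N => [|N IH]; first by rewrite big_nat1 !powR1 invr1 subrr mulr0 addr0.
  rewrite big_nat_recr//=; apply: (le_trans (lerD IH (lexx _))).
  rewrite -addrA lerD2l -(ler_pM2l b0) mulrDr !mulVKf ?gt_eqF//.
  have := powR_telescope N a1; lra.
by rewrite lerD2l -[leRHS]mulr1 ler_wpM2l ?invr_ge0 ?(ltW b0)//
  gerBl invr_ge0 powR_ge0.
Qed.

Lemma harmonic_unbounded (B : R) :
  exists N, B < \sum_(0 <= k < N) (k.+1%:R)^-1.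
Proof.
apply: contrapT => /forallNP h; apply: (@dvg_harmonic R).
apply: nondecreasing_is_cvgn.
  apply/nondecreasing_seqP => N; rewrite /series /= big_nat_recr//=.
  by rewrite lerDl invr_ge0.
exists B => _ [N _ <-]; rewrite /series/=; rewrite leNgt; exact/negP/h.
Qed.

End power_sums.

(** * Series of Haar functions along the corner cubes *)

Section corner_sums.
Variables (R : realType) (n : nat) (c : nat -> R).
Implicit Types (x : Rn R n) (k N : nat).
Local Notation lebn := (lebesgueRn R n).
Local Notation Q := (corner_cube n).

Definition corner_partial N x : R := \sum_(1 <= k < N) c k * corner_sign k x.

Definition corner_sum x : R := limn (fun N => corner_partial N x).

Lemma corner_partial_stable k N x : (0 < k)%N -> (k <= N)%N -> ~ cube (Q k) x ->
  corner_partial N x = corner_partial k x.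
Proof.
move=> k0 kN xQ; rewrite /corner_partial (big_cat_nat k0 kN) /=.
rewrite [X in _ + X]big_nat_cond [X in _ + X]big1 ?addr0// => j /andP[/andP[kj _] _].
rewrite corner_sign_out ?mulr0// => /(cube_corner_nested kj).
exact: xQ.
Qed.

Lemma corner_sum_partial k x : (0 < k)%N -> ~ cube (Q k) x ->
  corner_sum x = corner_partial k x.
Proof.
move=> k0 xQ; apply: lim_near_cst => //.
by exists k => // N /= kN; exact: corner_partial_stable.
Qed.

Lemma measurable_corner_partial N : measurable_fun setT (corner_partial N).
Proof.
apply: measurable_sum => k; apply: measurable_funM => //.
exact: measurable_corner_sign.
Qed.

(** The weights 2k - 1 are chosen for the identity 1 + 3 + ... + (2N - 1) = N^2: at a
    point of exactly N corner cubes this is N^2. The index 0 has weight 0. *)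
Definition corner_majorant x : \bar R :=
  (\sum_(0 <= k <oo) ((2 * k).-1%:R * \1_(cube (Q k)) x)%:E)%E.

Hypothesis n_gt0 : (0 < n)%N.

Lemma integrable_corner_majorant : lebn.-integrable setT corner_majorant.
Proof.
have mf k : measurable_fun setT
    (fun x => ((2 * k).-1%:R * \1_(cube (Q k)) x)%:E : \bar R).
  apply/measurable_EFinP; apply: measurable_funM => //.
  by apply: measurable_indic; exact: measurable_cube.
have f0 k x : (0 <= ((2 * k).-1%:R * \1_(cube (Q k)) x)%:E :> \bar R)%E.
  by rewrite lee_fin mulr_ge0// ler0n.
have G0 x : (0 <= corner_majorant x)%E by apply: nneseries_ge0.
apply/integrableP; split; first by apply: ge0_emeasurable_sum => //.
rewrite (eq_integral corner_majorant) => [|x _]; last by rewrite gee0_abs.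
rewrite integral_nneseries//.
apply: (@le_lt_trans _ _ 3%:E); last exact: ltry.
apply: lime_le; first by apply: is_cvg_nneseries => k _ _; exact: integral_ge0.
apply: nearW => N.
apply: (@le_trans _ _ (\sum_(0 <= k < N) (2 * k).-1%:R * 2^-1 ^+ k)%:E).
  rewrite -sumEFin; apply: lee_sum => k _.
  rewrite (eq_integral (fun x => (2 * k).-1%:R%:E * (\1_(cube (Q k)) x)%:E)%E) //.
  rewrite ge0_integralZl//; last first.
    by apply/measurable_EFinP; apply: measurable_indic; exact: measurable_cube.
  rewrite integral_indic//; last exact: measurable_cube.
  rewrite setIT [X in (_ * X)%E]lebesgueRn_cube -EFinM lee_fin ler_wpM2l//.
  rewrite -exprnN -exprVn -exprM.
  by rewrite ler_wiXn2l ?invr_ge0 ?invf_le1 ?ler1n// leq_pmulr.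
rewrite lee_fin (le_trans (odd_geometric_le _ N))// lerBlDr lerDl.
by rewrite mulr_ge0// exprn_ge0.
Qed.

Hypothesis c01 : forall k, 0 <= c k <= 1.

(** With 0 <= c_k <= 1 a partial sum is at most the number E of corner cubes, among
    those summed over, that contain x. The j-th of these cubes has index at least j, hence weight at
    least 2j - 1, so the majorant at x is at least 1 + 3 + ... + (2E - 1) = E^2. *)
Lemma corner_partial_le N x : (`|corner_partial N x|%:E <= corner_majorant x)%E /\
  ((corner_partial N x ^+ 2)%:E <= corner_majorant x)%E.
Proof.
pose I k : R := \1_(cube (Q k)) x.
pose E := \sum_(1 <= k < N) I k.
have I01 k : I k = 0 \/ I k = 1.
  by rewrite /I indicE; case: (_ \in _); [right|left].
have pE : `|corner_partial N x| <= E.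
  apply: le_trans (ler_norm_sum _ _ _) _; apply: ler_sum => k _.
  rewrite normrM normr_corner_sign -/(I k) ger0_norm; last by case/andP: (c01 k).
  by rewrite ler_piMl ?indic_ge0//; case/andP: (c01 k).
have DG : ((\sum_(1 <= k < N) (2 * k).-1%:R * I k)%:E <= corner_majorant x)%E.
  case: N {E pE} => [|N].
    by rewrite big_geq//; apply: nneseries_ge0 => k _ _; rewrite lee_fin mulr_ge0.
  apply: le_trans (nneseries_lim_ge N.+1 _); last first.
    by move=> k _ _; rewrite lee_fin mulr_ge0.
  by rewrite sumEFin [in leRHS]big_nat_recl//
    [X in (_ <= (X * _ + _)%:E)%E](_ : _ = 0)//
    mul0r add0r big_add1.
have ED : E <= \sum_(1 <= k < N) (2 * k).-1%:R * I k.
  rewrite /E big_nat_cond [leRHS]big_nat_cond.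
  apply: ler_sum => k /andP[/andP[k1 _] _]; rewrite ler_peMl ?indic_ge0//.
  by rewrite ler1n; lia.
split; first by apply: le_trans DG; rewrite lee_fin (le_trans pE).
apply: le_trans DG; rewrite lee_fin.
apply: (@le_trans _ _ (E ^+ 2)).
  by rewrite -real_normK ?num_real// lerXn2r ?nnegrE// (le_trans _ pE).
rewrite {ED pE}/E.
elim: N => [|[|N] IH]; [by rewrite !big_geq// expr0n..|].
have EN : 0 <= \sum_(1 <= k < N.+1) I k <= N%:R.
  rewrite sumr_ge0//= (@le_trans _ _ (\sum_(1 <= k < N.+1) 1))//.
    by apply: ler_sum => k _; case: (I01 k) => ->.
  by rewrite sumr_const_nat subSS subn0.
rewrite [in leLHS]big_nat_recr// [in leRHS]big_nat_recr//.
have -> : (2 * N.+1).-1 = (2 * N + 1)%N by lia.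
rewrite natrD natrM /=.
case: (I01 N.+1) => ->; first by rewrite mulr0 !addr0.
move: (\sum_(1 <= i < N.+1) I i) (\sum_(1 <= i < N.+1) _) IH EN => u v IH EN.
nra.
Qed.

Lemma cvg_corner_partial x :
  corner_partial N x @[N --> \oo] --> corner_sum x.
Proof.
have [K xK] := cube_corner_finite n_gt0 x.
rewrite (@corner_sum_partial K.+1)//; last exact: xK.
apply: cvg_near_cst; exists K.+1 => // N /= KN.
by apply: corner_partial_stable => //; exact: xK.
Qed.

Lemma measurable_corner_sum : measurable_fun setT corner_sum.
Proof.
apply: (measurable_fun_cvg measurable_corner_partial) => x _.
exact: cvg_corner_partial.
Qed.

Lemma corner_sum_le x : (`|corner_sum x|%:E <= corner_majorant x)%E /\
  ((corner_sum x ^+ 2)%:E <= corner_majorant x)%E.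
Proof.
have [K xK] := cube_corner_finite n_gt0 x.
by rewrite (@corner_sum_partial K.+1) ?xK//; [exact: corner_partial_le|exact: xK].
Qed.

Lemma corner_bounded_integrable (f h : Rn R n -> R) (M : R) : 0 <= M ->
  measurable_fun setT f -> (forall x, (`|f x|%:E <= corner_majorant x)%E) ->
  measurable_fun setT h -> (forall x, `|h x| <= M) ->
  lebn.-integrable setT (EFin \o (fun x => f x * h x)).
Proof.
move=> M0 mf fG mh hM.
apply: (le_integrable _ _ _ (integrableZl _ M integrable_corner_majorant)) => //.
  by apply/measurable_EFinP; exact: measurable_funM.
move=> x _ /=; have G0 : (0 <= corner_majorant x)%E.
  by apply: le_trans (fG x); rewrite lee_fin.
rewrite [leRHS]gee0_abs ?mule_ge0// normrM mulrC EFinM.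
by apply: lee_pmul => //; rewrite ?lee_fin.
Qed.

Lemma corner_sum_cvg_integral (h : Rn R n -> R) (M : R) : 0 <= M ->
  measurable_fun setT h -> (forall x, `|h x| <= M) ->
  (fun N => \int[lebn]_x (corner_partial N x * h x)) @ \oo -->
  \int[lebn]_x (corner_sum x * h x).
Proof.
move=> M0 mh hM.
have mS := measurable_corner_sum; have mp := measurable_corner_partial.
have iS : lebn.-integrable setT (EFin \o (fun x => corner_sum x * h x)).
  by apply: corner_bounded_integrable hM => // x; case: (corner_sum_le x).
apply: fine_cvg; rewrite fineK ?integrable_fin_num//.
have pS : {ae lebn, forall x, setT x ->
    (corner_partial N x * h x)%:E @[N --> \oo] --> (corner_sum x * h x)%:E}.
  apply: aeW => x _; apply/fine_cvgP; split; first exact: nearW.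
  by apply: cvgM; [exact: cvg_corner_partial|exact: cvg_cst].
have pG : {ae lebn, forall x N, setT x ->
    (`|(corner_partial N x * h x)%:E| <= M%:E * corner_majorant x)%E}.
  apply: aeW => x N _; rewrite /= normrM mulrC EFinM.
  by apply: lee_pmul; rewrite ?lee_fin//; case: (corner_partial_le N x).
have iG := integrableZl measurableT M integrable_corner_majorant.
have [_ _] := dominated_convergence measurableT
  (fun N => (measurable_EFinP _ _).2 (measurable_funM (mp N) mh))
  ((measurable_EFinP _ _).2 (measurable_funM mS mh)) pS iG pG.
exact.
Qed.

Lemma Rintegral_corner_partial (h : Rn R n -> R) (M : R) N : 0 <= M ->
  measurable_fun setT h -> (forall x, `|h x| <= M) ->
  \int[lebn]_x (corner_partial N x * h x) =
  \sum_(1 <= k < N) c k * \int[lebn]_x (corner_sign k x * h x).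
Proof.
move=> M0 mh hM.
have ip K : lebn.-integrable setT (EFin \o (fun x => corner_partial K x * h x)).
  apply: corner_bounded_integrable hM => //; first exact: measurable_corner_partial.
  by move=> x; case: (corner_partial_le K x).
have isg k : lebn.-integrable setT (EFin \o (fun x => corner_sign k x * h x)).
  apply: (@le_integrableR _ _ _ _ _ (fun x => M * \1_(cube (Q k)) x)).
  - by apply: measurable_funM => //; exact: measurable_corner_sign.
  - by move=> x; rewrite normrM normr_corner_sign mulrC ler_wpM2r// indic_ge0.
  - exact: (integrableZl _ M (integrable_cube R (Q k))).
elim: N => [|[|N] IH].
- rewrite big_geq//; under eq_Rintegral do rewrite /corner_partial big_geq// mul0r.
  by rewrite /Rintegral integral0.
- rewrite big_geq//; under eq_Rintegral do rewrite /corner_partial big_geq// mul0r.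
  by rewrite /Rintegral integral0.
rewrite big_nat_recr//= -IH -RintegralZl// -RintegralD//; last first.
  exact: (integrableZl _ (c N.+1) (isg _)).
apply: eq_Rintegral => x _; rewrite {1}/corner_partial big_nat_recr//=.
by rewrite mulrDl mulrA.
Qed.

Lemma Rintegral_corner_sign k : \int[lebn]_x corner_sign k x = 0.
Proof.
rewrite RintegralZl//; last exact: integrable_haar.
rewrite Rintegral_haar ?mulr0//; exact: (corner_haar_index n_gt0 k).
Qed.

Lemma Rintegral_corner_sum : \int[lebn]_x corner_sum x = 0.
Proof.
transitivity (\int[lebn]_x (corner_sum x * cst 1 x)).
  by apply: eq_Rintegral => x _; rewrite mulr1.
have m1 : measurable_fun setT (cst 1 : Rn R n -> R) by exact: measurable_cst.
have n1 (x : Rn R n) : `|(cst 1 : Rn R n -> R) x| <= 1 by rewrite normr1.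
have /cvg_lim <-// := corner_sum_cvg_integral ler01 m1 n1.
apply: lim_near_cst => //; apply: nearW => N.
rewrite (Rintegral_corner_partial N ler01 m1 n1).
rewrite big1// => k _; under eq_Rintegral do rewrite mulr1.
by rewrite Rintegral_corner_sign mulr0.
Qed.

Lemma corner_cube_inj : injective Q.
Proof. by move=> j k [/oppr_inj[]]. Qed.

(** The limit statement from which all Haar coefficients of the series are read
    off: by orthonormality at most one term of the sum is nonzero. *)
Lemma corner_sum_coef_cvg q : haar_indices q ->
  (fun N => \sum_(1 <= k < N) c k * ((haar1_height R (- k%:Z) ^+ n)^-1 *
     ((Q k, eps0 n) == q)%:R)) @ \oo --> inner corner_sum (haar q.1 q.2).
Proof.
move=> qH; set h := haar q.1 q.2; pose M := haar1_height R q.1.1 ^+ n.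
have M0 : 0 <= M by rewrite exprn_ge0// ltW// haar1_height_gt0.
have hM x : `|h x| <= M.
  by rewrite normr_haar ler_piMr// indicE lern1; case: (_ \in _).
have mh : measurable_fun setT h by exact: measurable_haar.
have := corner_sum_cvg_integral M0 mh hM; rewrite /inner; apply: cvg_trans.
apply: near_eq_cvg; apply: nearW => N; rewrite (Rintegral_corner_partial N M0 mh hM).
apply: eq_bigr => k _; congr (_ * _).
rewrite -(haar_orthonormal R (corner_haar_index n_gt0 k) qH) /inner /=.
rewrite -RintegralZl//.
  by apply: eq_Rintegral => x _; rewrite mulrA.
apply: (@le_integrableR _ _ _ _ _
  (fun x => haar1_height R (- k%:Z) ^+ n * M * \1_(cube (Q k)) x)).
- by apply: measurable_funM => //; exact: measurable_haar.
- move=> x; rewrite normrM normr_haar /= mulrAC ler_wpM2r ?indic_ge0//.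
  by rewrite ler_wpM2l// exprn_ge0// ltW// haar1_height_gt0.
- exact: (integrableZl _ _ (integrable_cube R (Q k))).
Qed.

Lemma inner_corner_sum j : (0 < j)%N ->
  inner corner_sum (haar (Q j) (eps0 n)) = c j / haar1_height R (- j%:Z) ^+ n.
Proof.
move=> j0; have /cvg_lim <-// := corner_sum_coef_cvg (corner_haar_index n_gt0 j).
apply: lim_near_cst => //; exists j.+1 => // N /= jN.
rewrite (bigD1_seq j) ?mem_index_iota ?j0 ?iota_uniq//= eqxx mulr1 big1 ?addr0//.
move=> k kj; case: eqP => [[/oppr_inj[kj']]|_]; last by rewrite !mulr0.
by rewrite kj' eqxx in kj.
Qed.

Lemma inner_corner_sum_other q : haar_indices q ->
  (forall j, (0 < j)%N -> q <> (Q j, eps0 n)) ->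
  inner corner_sum (haar q.1 q.2) = 0.
Proof.
move=> qH qj; have /cvg_lim <-// := corner_sum_coef_cvg qH.
apply: lim_near_cst => //; apply: nearW => N.
rewrite big_nat_cond big1// => k /andP[/andP[k1 _] _].
by case: eqP => [qk|_]; [case: (qj k k1)|rewrite !mulr0].
Qed.

(** * The square of such a series *)

Lemma corner_height_vol k :
  (haar1_height R (- k%:Z) ^+ n) ^+ 2 * cube_vol R (Q k) = 1.
Proof. by rewrite cube_volE exprAC -exprMn haar1_heightK expr1n. Qed.

Lemma cube_vol_gt0 k : 0 < cube_vol R (Q k).
Proof. by rewrite cube_volE exprn_gt0// exp2z_gt0. Qed.

Lemma corner_partial_deep k x : cube (Q k) x ->
  corner_partial k x = \sum_(1 <= j < k) c j.
Proof.
move=> xQ; rewrite /corner_partial !big_nat; apply: eq_bigr => j /andP[_ jk].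
rewrite corner_sign_next ?mulr1//; exact: cube_corner_nested xQ.
Qed.

(** Off Q_k everything vanishes. On Q_k the series is A + c_k sigma_k + T with
    sigma_k = 1 or -1, and T = 0 unless sigma_k = 1; hence T sigma_k = T. *)
Lemma corner_sum_sqr_sign k x : (0 < k)%N ->
  let A := \sum_(1 <= j < k) c j in
  let T := corner_sum x - corner_partial k.+1 x in
  corner_sum x ^+ 2 * corner_sign k x =
    (A ^+ 2 + c k ^+ 2) * corner_sign k x + 2 * A * c k * \1_(cube (Q k)) x +
    2 * (A + c k) * T + T ^+ 2.
Proof.
move=> k0 A T.
have pS : corner_partial k.+1 x = corner_partial k x + c k * corner_sign k x.
  by rewrite /corner_partial big_nat_recr.
have [xQ|xQ] := pselect (cube (Q k) x); last first.
  have -> : T = 0.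
    rewrite /T pS (corner_sum_partial k0 xQ) (corner_sign_out xQ).
    by rewrite mulr0 addr0 subrr.
  rewrite (corner_sign_out xQ) indicE memNset//.
  by rewrite !mulr0 expr0n !addr0.
have SE : corner_sum x = A + c k * corner_sign k x + T.
  by rewrite /T pS (corner_partial_deep xQ) -/A addrC subrK.
have s2 := corner_sign_sqr xQ.
rewrite SE indicE mem_set// mulr1.
have [xQ'|xQ'] := pselect (cube (Q k.+1) x).
  rewrite (corner_sign_next xQ'); ring.
have -> : T = 0 by rewrite /T (corner_sum_partial (ltn0Sn k) xQ') subrr.
rewrite -[in RHS](mulr1 (2 * A * c k)) -s2.
set s := corner_sign k x in s2 *.
have -> : (A + c k * s + 0) ^+ 2 * s =
   A ^+ 2 * s + 2 * A * c k * s ^+ 2 + c k ^+ 2 * s * s ^+ 2 by ring.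
by rewrite s2; ring.
Qed.

Lemma corner_sum_sqr_integrable :
  lebn.-integrable setT (EFin \o (fun x => corner_sum x ^+ 2)).
Proof.
have iG := integrable_corner_majorant; apply: le_integrable iG => //.
  by apply/measurable_EFinP; apply: measurable_funX; exact: measurable_corner_sum.
move=> x _ /=; have [_ h] := corner_sum_le x.
rewrite ger0_norm ?sqr_ge0// gee0_abs// (le_trans _ h)// lee_fin sqr_ge0//.
Qed.

Lemma corner_sum_integrable : lebn.-integrable setT (EFin \o corner_sum).
Proof.
have iG := integrable_corner_majorant; apply: le_integrable iG => //.
  by apply/measurable_EFinP; exact: measurable_corner_sum.
move=> x _ /=; have [h _] := corner_sum_le x.
by rewrite gee0_abs// (le_trans _ h).
Qed.

Lemma corner_partial_integrable N : lebn.-integrable setT (EFin \o corner_partial N).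
Proof.
have iG := integrable_corner_majorant; apply: le_integrable iG => //.
  by apply/measurable_EFinP; exact: measurable_corner_partial.
move=> x _ /=; have [h _] := corner_partial_le N x.
by rewrite gee0_abs// (le_trans _ h).
Qed.

(** In the expansion of [corner_sum_sqr_sign] only the term in 1_{Q_k} and the
    nonnegative T^2 contribute to the integral. *)
Lemma inner_corner_sum_sqr_ge k : (0 < k)%N ->
  2 * (\sum_(1 <= j < k) c j) * c k *
    (haar1_height R (- k%:Z) ^+ n * cube_vol R (Q k)) <=
  inner (fun x => corner_sum x ^+ 2) (haar (Q k) (eps0 n)).
Proof.
move=> k0; set A := \sum_(1 <= j < k) c j; set H := haar1_height R (- k%:Z) ^+ n.
have H0 : 0 < H by rewrite exprn_gt0// haar1_height_gt0.
pose T x := corner_sum x - corner_partial k.+1 x.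
have mSs : measurable_fun setT (fun x => corner_sum x ^+ 2 * corner_sign k x).
  apply: measurable_funM; last exact: measurable_corner_sign.
  by apply: measurable_funX; exact: measurable_corner_sum.
have iSs : lebn.-integrable setT (EFin \o (fun x => corner_sum x ^+ 2 * corner_sign k x)).
  apply: le_integrableR corner_sum_sqr_integrable => //.
  move=> x; rewrite normrM normr_corner_sign (ger0_norm (sqr_ge0 _)).
  by rewrite ler_piMr ?sqr_ge0// indicE lern1; case: (_ \in _).
have is1 : lebn.-integrable setT (EFin \o corner_sign k).
  exact: (integrableZl _ _ (integrable_haar R (Q k) (eps0 n))).
have iT : lebn.-integrable setT (EFin \o T).
  exact: (integrableB _ corner_sum_integrable (corner_partial_integrable k.+1)).
have T0 : \int[lebn]_x T x = 0.
  rewrite RintegralB//; [|exact: corner_sum_integrable|exact: corner_partial_integrable].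
  rewrite Rintegral_corner_sum sub0r.
  transitivity (- \int[lebn]_x (corner_partial k.+1 x * cst 1 x)).
    by congr (- _); apply: eq_Rintegral => x _; rewrite mulr1.
  rewrite (@Rintegral_corner_partial _ 1)//; last by move=> x; rewrite normr1.
  rewrite big1 ?oppr0// => j _; under eq_Rintegral do rewrite mulr1.
  by rewrite Rintegral_corner_sign mulr0.
have -> : inner (fun x => corner_sum x ^+ 2) (haar (Q k) (eps0 n)) =
    H * \int[lebn]_x (corner_sum x ^+ 2 * corner_sign k x).
  rewrite -RintegralZl//; apply: eq_Rintegral => x _.
  by rewrite haar_corner mulrCA.
rewrite mulrCA ler_wpM2l ?(ltW H0)//.
pose L x := (A ^+ 2 + c k ^+ 2) * corner_sign k x +
  2 * A * c k * \1_(cube (Q k)) x + 2 * (A + c k) * T x.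
have i1 := integrableZl measurableT (A ^+ 2 + c k ^+ 2) is1.
have i2 := integrableZl measurableT (2 * A * c k) (integrable_cube R (Q k)).
have i3 := integrableZl measurableT (2 * (A + c k)) iT.
have i12 := integrableD measurableT i1 i2.
have iL : lebn.-integrable setT (EFin \o L) by exact: (integrableD _ i12 i3).
have <- : \int[lebn]_x L x = 2 * A * c k * cube_vol R (Q k).
  rewrite RintegralD// RintegralD// (RintegralZl _ measurableT is1).
  rewrite (RintegralZl _ measurableT (integrable_cube R (Q k))).
  rewrite (RintegralZl _ measurableT iT).
  by rewrite Rintegral_corner_sign T0 Rintegral_cube cube_volE !mulr0 addr0 add0r.
apply: le_Rintegral => // x _.
by rewrite corner_sum_sqr_sign// lerDl sqr_ge0.
Qed.

(** * Sobolev sums *)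

Let corner_index k : dyadic n * {ffun 'I_n -> bool} := (Q k.+1, eps0 n).

Let corner_index_inj : set_inj setT corner_index.
Proof. by move=> j k _ _ /(congr1 fst)/corner_cube_inj[]. Qed.

(** At the critical order s = n/2 the weight is the inverse volume. *)
Lemma sobolev_weight (q : dyadic n) :
  cube_vol R q `^ (- (2 * (n%:R / 2) / n%:R)) = (cube_vol R q)^-1 :> R.
Proof.
rewrite mulrCA divff ?pnatr_eq0// mulr1 divff ?pnatr_eq0 -?lt0n//.
by rewrite powR_inv1// cube_volE exprn_ge0// ltW// exp2z_gt0.
Qed.

Lemma corner_sum_Lfun : corner_sum \in Lfun lebn 2%:E.
Proof.
rewrite inE; apply/andP; split; rewrite inE/=; first exact: measurable_corner_sum.
rewrite /finite_norm unlock /= poweR_lty//.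
have /integrableP[_] := corner_sum_sqr_integrable; apply: le_lt_trans.
apply: ge0_le_integral => //.
- apply/measurable_EFinP; apply: (measurableT_comp (measurable_powR _)) => //.
  by apply: measurableT_comp => //; exact: measurable_corner_sum.
- apply: measurableT_comp => //.
  by apply/measurable_EFinP; apply: measurable_funX; exact: measurable_corner_sum.
by move=> x _; rewrite lee_fin powR_mulrn// normrX.
Qed.

(** The weight |Q_k|^-1 compensates the factor |Q_k| of the squared coefficient, so
    the Sobolev sum is the sum of the squares of the c_k. *)
Lemma corner_sum_sobolev (B : R) :
  (forall N, \sum_(0 <= k < N) c k.+1 ^+ 2 <= B) ->
  dyadic_sobolev (n%:R / 2) corner_sum.
Proof.
move=> cB; split; first exact: corner_sum_Lfun.
set g := (g in \esum_(q in _) g q).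
have -> : \esum_(q in @haar_indices n) g q = \esum_(q in corner_index @` setT) g q.
  rewrite esum_mkcond [RHS]esum_mkcond; apply: eq_esum => q _.
  have [[k _ <-]|qk] := pselect ((corner_index @` setT) q).
    rewrite mem_set; last exact: corner_haar_index.
    by rewrite mem_set//; exists k.
  rewrite [in RHS]memNset//; case: ifPn => //; rewrite inE => qH.
  rewrite /g inner_corner_sum_other ?normr0 ?expr0n ?mulr0// => -[//|j] _ qj.
  by apply: qk; exists j.
rewrite esum_image// -nneseries_esumT; last first.
  by move=> k; rewrite lee_fin mulr_ge0 ?powR_ge0 ?exprn_ge0.
apply: (@le_lt_trans _ _ B%:E); last exact: ltry.
apply: lime_le.
  by apply: is_cvg_nneseries => k _ _; rewrite lee_fin mulr_ge0 ?powR_ge0 ?exprn_ge0.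
apply: nearW => N; rewrite /g sumEFin lee_fin; apply: le_trans (cB N).
apply: ler_sum => k _.
rewrite sobolev_weight inner_corner_sum// real_normK ?num_real// exprMn.
have := corner_height_vol k.+1; have := cube_vol_gt0 k.+1.
set V := cube_vol _ _; set H := _ ^+ n => V0 HV.
have H20 : H ^+ 2 != 0
  by apply: contraPneq HV => ->; rewrite mul0r => /esym/eqP; rewrite oner_eq0.
have -> : V = (H ^+ 2)^-1 by rewrite -[LHS]mul1r -(mulVf H20) -mulrA HV mulr1.
by rewrite invrK exprVn mulrCA mulfV// mulr1.
Qed.

(** Restricting the Sobolev sum to the corner cubes already makes it infinite. *)
Lemma corner_sum_sqr_not_sobolev :
  (forall B, exists N,
    B < \sum_(0 <= k < N) (2 * (\sum_(1 <= j < k.+1) c j) * c k.+1) ^+ 2) ->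
  ~ dyadic_sobolev (n%:R / 2) (fun x => corner_sum x ^+ 2).
Proof.
move=> cB [_]; apply/negP; rewrite -leNgt leye_eq; apply/eqP.
set g := (g in \esum_(q in _) g q).
have g0 q : (0 <= g q)%E by rewrite lee_fin mulr_ge0 ?powR_ge0 ?exprn_ge0.
apply/eqyP => B B0; have [N BN] := cB B.
apply: (@le_trans _ _ (\esum_(q in corner_index @` setT) g q)); last first.
  rewrite esum_mkcond [leRHS]esum_mkcond; apply: le_esum => q _.
  case: ifPn => [|_]; last by case: ifPn => _; [exact: g0|].
  rewrite inE => -[k _ <-]; rewrite mem_set//; exact: corner_haar_index.
rewrite esum_image// -nneseries_esumT//.
apply: le_trans (nneseries_lim_ge N _) => //.
apply: (@le_trans _ _ (\sum_(0 <= k < N)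
    (2 * (\sum_(1 <= j < k.+1) c j) * c k.+1) ^+ 2)%:E).
  by rewrite lee_fin ltW.
rewrite -sumEFin; apply: lee_sum => k _; rewrite lee_fin sobolev_weight.
have := inner_corner_sum_sqr_ge (ltn0Sn k).
have := corner_height_vol k.+1; have := cube_vol_gt0 k.+1.
set u := 2 * _ * _; set V := cube_vol _ _; set H := _ ^+ n; set J := inner _ _.
move=> V0 HV uJ.
have u0 : 0 <= u.
  rewrite mulr_ge0//; last by case/andP: (c01 k.+1).
  by rewrite mulr_ge0// sumr_ge0// => j _; case/andP: (c01 j).
have H0 : 0 < H by rewrite exprn_gt0// haar1_height_gt0.
rewrite real_normK ?num_real//.
have -> : u ^+ 2 = V^-1 * (u * (H * V)) ^+ 2.
  have -> : (u * (H * V)) ^+ 2 = u ^+ 2 * (H ^+ 2 * V) * V by ring.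
  by rewrite HV mulr1 mulrC mulfK// gt_eqF.
rewrite ler_wpM2l ?invr_ge0 ?(ltW V0)//.
have uHV : 0 <= u * (H * V) := mulr_ge0 u0 (mulr_ge0 (ltW H0) (ltW V0)).
by rewrite lerXn2r ?nnegrE// (le_trans uHV).
Qed.

End corner_sums.

(** * The coefficients k^(-alpha/2) *)

Section corner_coefficients.
Variable R : realType.
Implicit Types (k : nat).

Definition corner_coef (alpha : R) k : R := (k%:R `^ (alpha / 2))^-1.

Lemma corner_coef_sqr alpha k :
  corner_coef alpha k ^+ 2 = (k%:R `^ alpha)^-1.
Proof.
rewrite exprVn -powR_mulrn ?powR_ge0// -powRrM.
by congr ((_ `^ _)^-1); rewrite divfK ?pnatr_eq0.
Qed.

Variable alpha : R.
Hypothesis alpha_gt1 : 1 < alpha.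
Local Notation c := (corner_coef alpha).

Let a0 : 0 < alpha / 2.
Proof. by rewrite divr_gt0// (lt_trans ltr01). Qed.

Lemma corner_coef01 k : 0 <= c k <= 1.
Proof.
rewrite /corner_coef invr_ge0 powR_ge0 /=; case: k => [|k].
  by rewrite powR0 ?invr0// gt_eqF.
by rewrite invf_le1 ?powR_gt0// -[leLHS](powRr0 k.+1%:R) ler_powR ?ler1n// ltW.
Qed.

Lemma corner_coef_nonincreasing j k : (0 < j)%N -> (j <= k)%N -> c k <= c j.
Proof.
move=> j0 jk; have k0 := leq_trans j0 jk.
by rewrite /corner_coef lef_pV2 ?posrE ?powR_gt0 ?ltr0n//
  ge0_ler_powR ?nnegrE ?ler_nat// ltW.
Qed.

(** Each of the k terms of the inner sum is at least c_{k+1}, whose square is at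
    least (k + 1)^(-3/2) since alpha <= 3/2; then use 2k >= k + 1. *)
Lemma corner_coef_lower k : alpha <= 3 / 2 -> (0 < k)%N ->
  (k.+1%:R)^-1 <= (2 * (\sum_(1 <= j < k.+1) c j) * c k.+1) ^+ 2.
Proof.
move=> a32 k0.
have cA : k%:R * c k.+1 <= \sum_(1 <= j < k.+1) c j.
  have -> : k%:R * c k.+1 = \sum_(1 <= j < k.+1) c k.+1.
    by rewrite sumr_const_nat subn1 mulr_natl.
  rewrite !big_nat; apply: ler_sum => j /andP[j1 jk].
  by apply: corner_coef_nonincreasing => //; exact: ltnW.
have [c0 _] := andP (corner_coef01 k.+1).
apply: (@le_trans _ _ ((2 * k%:R * c k.+1 ^+ 2) ^+ 2)); last first.
  rewrite lerXn2r ?nnegrE ?mulr_ge0 ?sqr_ge0 ?sumr_ge0//.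
    by move=> j _; case/andP: (corner_coef01 j).
  by rewrite expr2 mulrA ler_wpM2r// -mulrA ler_wpM2l.
rewrite corner_coef_sqr exprMn exprVn.
set y : R := k.+1%:R; have y1 : 1 <= y by rewrite ler1n.
have y0 : 0 < y by rewrite ltr0n.
have ya : (y `^ alpha) ^+ 2 <= y ^+ 3.
  rewrite -[leRHS]powR_mulrn ?(ltW y0)// -[leLHS]powR_mulrn ?powR_ge0// -powRrM.
  have a3 : alpha * 2 <= 3 by lra.
  by rewrite ler_powR.
have ya0 : 0 < (y `^ alpha) ^+ 2 by rewrite exprn_gt0// powR_gt0.
apply: (@le_trans _ _ ((2 * k%:R) ^+ 2 * (y ^+ 3)^-1)); last first.
  by rewrite ler_wpM2l ?sqr_ge0// lef_pV2 ?posrE ?exprn_gt0 ?powR_gt0.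
rewrite ler_pdivlMr ?exprn_gt0// exprS mulKf ?gt_eqF//.
rewrite lerXn2r ?nnegrE ?(ltW y0) ?mulr_ge0// /y -natrM ler_nat; lia.
Qed.

End corner_coefficients.

Lemma corner_seriesE (R : realType) (n : nat) (alpha : R) : corner_series alpha =
  corner_sum (corner_coef alpha) :> (Rn R n -> R).
Proof.
apply/funext => x; rewrite /corner_series /corner_sum /corner_partial.
congr (limn _); apply/funext => N; apply: eq_bigr => k _.
rewrite haar_corner mulrA; congr (_ * _).
have -> : haar1_height R (- k%:Z) ^+ n = 2 `^ ((k * n)%:R / 2).
  rewrite /haar1_height -powR_intmul// -powRrM -powR_mulrn ?powR_ge0// -powRrM.
  congr (_ `^ _); rewrite natrM intrN; ring.
by rewrite invfM mulrAC mulVf ?mul1r// gt_eqF// powR_gt0.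
Qed.

Theorem proposition13 (R : realType) (n : nat) (hn : (1 <= n)%N) :
  ~ pointwise_algebra (@dyadic_sobolev R n (n%:R / 2)) /\
  (forall alpha : R, 1 < alpha -> alpha <= 3 / 2 ->
     @dyadic_sobolev R n (n%:R / 2) (corner_series alpha) /\
     ~ @dyadic_sobolev R n (n%:R / 2) (fun x => corner_series alpha x ^+ 2)).
Proof.
have part2 : forall alpha : R, 1 < alpha -> alpha <= 3 / 2 ->
     @dyadic_sobolev R n (n%:R / 2) (corner_series alpha) /\
     ~ @dyadic_sobolev R n (n%:R / 2) (fun x => corner_series alpha x ^+ 2).
  move=> alpha a1 a32; have c01 := corner_coef01 a1.
  rewrite corner_seriesE; split.
    apply: (corner_sum_sobolev hn c01 (B := 1 + (alpha - 1)^-1)) => N.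
    under eq_bigr do rewrite corner_coef_sqr.
    exact: sum_powR_le.
  apply: (corner_sum_sqr_not_sobolev hn c01) => B.
  (* The comparison with the harmonic series fails at its first term, where A_1 = 0. *)
  have [N BN] := harmonic_unbounded (B + 1).
  exists N; case: N BN => [|N] BN.
    by move: BN; rewrite !big_geq// => BN; lra.
  rewrite big_nat_recl//= in BN *; rewrite big_nat_recl//=.
  rewrite invr1 in BN.
  apply: (@lt_le_trans _ _ (\sum_(0 <= i < N) (i.+2%:R)^-1)); first lra.
  rewrite ler_wpDl ?sqr_ge0//; apply: ler_sum => k _.
  exact: corner_coef_lower.
split=> // alg; have h1 : 1 < 3 / 2 :> R by lra.
have [f1 f2] := part2 (3 / 2) h1 (lexx _).
apply: f2; rewrite (_ : (fun x => _) =
  fun x => corner_series (3 / 2) x * corner_series (3 / 2) x); first exact: alg.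
by apply/funext => x; rewrite expr2.
Qed.
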